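(* One has $J''(\bar\beta)=(1+4r)^{3/2}/r$. Consequently, for every $\varepsilon>0$ there are $\delta,C>0$ such that for all $0<s\le\delta$ and all integers $n\ge1$, $$\mathbb{P}\left(\left|\frac{|\pi(Z_n)|}{n}-\bar\beta\right|\ge s\right)\le C\,n^{3}\exp\left(-n\,s^{2}\left(\frac{(1+4r)^{3/2}}{2r}-\varepsilon\right)\right),$$ where $Z_n$ is uniformly distributed on the ball $B(n)$. For $r=1$ the Gaussian constant is $(1+4r)^{3/2}/(2r)=\frac{5\sqrt5}{2}$.
   Context: Let $F$ be a finite group with identity $e$ and $|F|=r+1\ge2$. Let $L_F=F\wr\mathbb{Z}$ be the group of pairs $x=(\eta,j)$ with $\eta:\mathbb{Z}\to F$ finitely supported and $j\in\mathbb{Z}$, with multiplication $(\eta,j)(\eta',j')=(\eta\cdot\tau_j\eta',\,j+j')$, where $\tau_j\eta'(i)=\eta'(i-j)$ and the product of configurations is pointwise in $F$. The standard generating set is $S=\{t^{\pm1}\}\cup(F\setminus\{e\})$, where $t=(\mathbf{e},1)$ with $\mathbf e$ the trivial configuration, and $c\in F\setminus\{e\}$ is identified with $(\delta^c,0)$, $\delta^c$ being equal to $c$ at $0$ and trivial elsewhere. Let $|x|$ be the word length with respect to $S$, $B(n)=\{x\in L_F:|x|\le n\}$, and $\pi(\eta,j)=j$ the cursor homomorphism. For $j\in\mathbb{Z}$, $n\ge0$ put $N_j(n)=\#\{x\in B(n):\pi(x)=j\}$. The directional growth spectrum is $I(\beta)=\lim_{n\to\infty}\frac1n\log N_{\lfloor\beta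 n\rfloor}(n)$ for $\beta\in[-1,1]$ (the limit exists for every such $\beta$). Let $\omega=\frac{1+\sqrt{1+4r}}2$ (so $\omega^2=\omega+r$), $\bar\beta=\frac{\omega^2}{\omega^2+r}$, and $J=\log\omega-I$. *)

(* Defs.v *)
From HB Require Import structures.
From mathcomp Require Import all_boot all_order all_algebra all_fingroup finmap.
From mathcomp Require Import all_classical all_reals all_analysis.

Set Implicit Arguments.
Unset Strict Implicit.
Unset Printing Implicit Defensive.

Import Order.TTheory GRing.Theory Num.Theory.
Import numFieldNormedType.Exports.

Local Open Scope classical_set_scope.
Local Open Scope ring_scope.

Section Configurations.
Variable F : finGroupType.

Definition config := {fsfun int -> F with 1%g}.

HB.instance Definition _ := [Choice of config by <:].

Definition config1 : config := [fsfun with 1%g].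

Definition config_mul (f g : config) : config :=
  [fsfun i in (finsupp f `|` finsupp g)%fset => (f i * g i)%g | 1%g].

Definition config_inv (f : config) : config :=
  [fsfun i in finsupp f => ((f i)^-1)%g | 1%g].

Definition config_shift (j : int) (f : config) : config :=
  [fsfun i in [fset (k + j)%R | k in finsupp f]%fset => f (i - j) | 1%g].

Definition config_single (c : F) : config :=
  [fsfun i in [fset 0%R]%fset => c | 1%g].

Lemma config1E i : config1 i = 1%g.
Proof. by rewrite fsfunE. Qed.

Lemma config_mulE f g i : config_mul f g i = (f i * g i)%g.
Proof.
rewrite fsfunE in_fsetU.
by case: finsuppP => //= _; case: finsuppP => //= _; rewrite mulg1.
Qed.

Lemma config_invE f i : config_inv f i = ((f i)^-1)%g.
Proof. by rewrite fsfunE; case: finsuppP => //; rewrite invg1. Qed.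

Lemma config_shiftE j f i : config_shift j f i = f (i - j).
Proof.
rewrite fsfunE; case: ifP => // /negP h.
have [//|hf] := finsuppP f (i - j).
by case: h; apply/imfsetP; exists (i - j) => //; rewrite addrNK.
Qed.

Lemma config_singleE c i : config_single c i = if i == 0 then c else 1%g.
Proof. by rewrite fsfunE in_fset1. Qed.

End Configurations.

(* The wreath product F wr Z, i.e. the semidirect product of the finitely
   supported configurations by Z acting by translation. *)
Definition lamplighter (F : finGroupType) : Type := (config F * int)%type.

Section LamplighterGroup.
Variable F : finGroupType.
Implicit Types x y z : lamplighter F.

Definition ll_one : lamplighter F := (config1 F, 0).

Definition ll_mul x y : lamplighter F :=
  (config_mul x.1 (config_shift x.2 y.1), x.2 + y.2).

Definition ll_inv x : lamplighter F :=
  (config_shift (- x.2) (config_inv x.1), - x.2).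

HB.instance Definition _ := Choice.copy (lamplighter F) (config F * int)%type.

Lemma ll_mulA : associative ll_mul.
Proof.
move=> x y z; congr pair; rewrite /= ?addrA//; apply/fsfunP => i.
by rewrite !(config_mulE, config_shiftE) mulgA opprD addrA.
Qed.

Lemma ll_mul1 : left_id ll_one ll_mul.
Proof.
case=> f j; congr pair; rewrite /= ?add0r//; apply/fsfunP => i.
by rewrite config_mulE config_shiftE config1E mul1g subr0.
Qed.

Lemma ll_mulr1 : right_id ll_one ll_mul.
Proof.
case=> f j; congr pair; rewrite /= ?addr0//; apply/fsfunP => i.
by rewrite config_mulE config_shiftE config1E mulg1.
Qed.

Lemma ll_mulV : left_inverse ll_one ll_inv ll_mul.
Proof.
move=> x; congr pair; rewrite /= ?addNr//; apply/fsfunP => i.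
by rewrite !(config_mulE, config_shiftE, config_invE) config1E opprK mulVg.
Qed.

Lemma ll_mulrV : right_inverse ll_one ll_inv ll_mul.
Proof.
move=> x; congr pair; rewrite /= ?addrN//; apply/fsfunP => i.
rewrite !(config_mulE, config_shiftE, config_invE) config1E opprK subrK.
by rewrite mulgV.
Qed.

HB.instance Definition _ := isGroup.Build (lamplighter F)
  ll_mulA ll_mul1 ll_mulr1 ll_mulV ll_mulrV.

HB.instance Definition _ := isPointed.Build (lamplighter F) ll_one.

HB.instance Definition _ := @isMeasurable.Build default_measure_display
  (lamplighter F) discrete_measurable discrete_measurable0
  discrete_measurableC discrete_measurableU.

Definition cursor x : int := x.2.

Definition ll_t : lamplighter F := (config1 F, 1).

Definition ll_lamp (c : F) : lamplighter F := (config_single c, 0).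

Definition std_gens : set (lamplighter F) :=
  [set ll_t; (ll_t^-1)%g] `|` [set ll_lamp c | c in [set c | c != 1%g]].

Definition is_word_of x (w : seq (lamplighter F)) : Prop :=
  (forall s, s \in w -> std_gens s) /\ (\prod_(s <- w) s)%g = x.

Definition has_word_of_size x : pred nat :=
  fun n => `[< exists2 w, is_word_of x w & size w = n >].

Lemma is_word_cat x y v w :
  is_word_of x v -> is_word_of y w -> is_word_of (x * y)%g (v ++ w).
Proof.
move=> [hv <-] [hw <-]; split; last by rewrite big_cat.
by move=> s; rewrite mem_cat => /orP[/hv|/hw].
Qed.

Lemma is_word1 s : std_gens s -> is_word_of s [:: s].
Proof. by move=> hs; split; [move=> u; rewrite inE => /eqP->|rewrite big_seq1]. Qed.

Lemma is_word_translate j : exists w, is_word_of (config1 F, j) w.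
Proof.
have hpos (k : nat) : exists w, is_word_of (config1 F, k%:Z) w.
  elim: k => [|k [w hw]]; first by exists [::]; split => //; rewrite big_nil.
  exists (w ++ [:: ll_t]).
  have ht : is_word_of ll_t [:: ll_t] by apply: is_word1; left; left.
  have := is_word_cat hw ht; congr is_word_of.
  congr pair; last by rewrite /= -addn1 PoszD.
  by apply/fsfunP => i; rewrite config_mulE config_shiftE !config1E mulg1.
have hneg (k : nat) : exists w, is_word_of (config1 F, - k%:Z) w.
  elim: k => [|k [w hw]]; first by exists [::]; split => //; rewrite big_nil.
  exists (w ++ [:: (ll_t^-1)%g]).
  have ht : is_word_of (ll_t^-1)%g [:: (ll_t^-1)%g].
    by apply: is_word1; left; right.
  have := is_word_cat hw ht; congr is_word_of.
  congr pair; last by rewrite /= -addn1 PoszD opprD.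
  apply/fsfunP => i; rewrite config_mulE !config_shiftE config_invE !config1E.
  by rewrite invg1 mulg1.
by case: j => k; [exact: hpos | rewrite NegzE; exact: hneg].
Qed.

Lemma is_word_exists x : exists w, is_word_of x w.
Proof.
case: x => f j.
suff [w hw] : exists w, is_word_of (f, 0) w.
  have [v hv] := is_word_translate j.
  exists (w ++ v); have := is_word_cat hw hv; congr is_word_of.
  congr pair; last by rewrite /= add0r.
  by apply/fsfunP => i; rewrite config_mulE config_shiftE config1E mulg1.
have [n] := ubnP #|` finsupp f|; elim: n f => // n IHn f ltfn.
have [f0|[i fi]] := fset_0Vmem (finsupp f).
  exists [::]; split => //; rewrite big_nil; congr pair.
  apply/fsfunP => i; rewrite config1E fsfun_dflt//.
  by rewrite f0.
pose g : config F := [fsfun k in (finsupp f `\ i)%fset => f k | 1%g].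
have gE k : g k = if k == i then 1%g else f k.
  rewrite fsfunE in_fsetD1; case: eqVneq => //= _.
  by case: finsuppP.
have [|w hw] := IHn g.
  rewrite ltnS in ltfn; apply: leq_trans ltfn.
  apply: (@leq_ltn_trans #|` (finsupp f `\ i)%fset|); last first.
    by rewrite [leqRHS](cardfsD1 i) fi add1n.
  apply: fsubset_leq_card; apply/fsubsetP => k.
  rewrite mem_finsupp gE in_fsetD1; case: (eqVneq k i) => [_|_ /=]; first by rewrite eqxx.
  by rewrite mem_finsupp.
have [v hv] := is_word_translate i.
have [u hu] := is_word_translate (- i).
have hl : is_word_of (ll_lamp (f i)) [:: ll_lamp (f i)].
  apply: is_word1; right; exists (f i) => //=.
  by rewrite mem_finsupp in fi.
exists (((v ++ [:: ll_lamp (f i)]) ++ u) ++ w).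
have := is_word_cat (is_word_cat (is_word_cat hv hl) hu) hw; congr is_word_of.
congr pair; last by rewrite /= !addr0 subrr.
apply/fsfunP => k.
rewrite !(config_mulE, config_shiftE) /= config_singleE gE !config1E.
rewrite addr0 subrr subr0 mulg1 mul1g subr_eq0.
by case: (eqVneq k i) => [->|_]; rewrite ?mulg1 ?mul1g.
Qed.

Lemma has_word_exists x : exists n, has_word_of_size x n.
Proof. by have [w hw] := is_word_exists x; exists (size w); apply/asboolP; exists w. Qed.

Definition word_length x : nat := ex_minn (has_word_exists x).

Definition word_ball (n : nat) : set (lamplighter F) :=
  [set x | (word_length x <= n)%N].

Lemma finite_word_ball n : finite_set (word_ball n).
Proof.
have finS : finite_set std_gens.
  rewrite finite_setU; split; first by rewrite finite_setU; split; exact: finite_set1.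
  by apply: finite_image; exact: finite_finset.
pose W := fix W n : set (seq (lamplighter F)) :=
  if n is m.+1 then [set [::]] `|` [set s :: w | s in std_gens & w in W m]
  else [set [::]].
have finW m : finite_set (W m).
  elim: m => [|m IHm] /=; first exact: finite_set1.
  by rewrite finite_setU; split; [exact: finite_set1 | exact: finite_image2].
apply: sub_finite_set (finite_image (fun w => \prod_(s <- w) s)%g (finW n)).
move=> x; rewrite /word_ball /= /word_length; case: ex_minnP => m /asboolP[w [hw wx] <-] _.
move=> lewn; exists w => //; elim: w n lewn hw {wx} => [|s w IHw] [|k] //=.
  by move=> _ _; left.
rewrite ltnS => lewk hw; right; exists s; first by apply: hw; rewrite mem_head.
by exists w => //; apply: IHw => // u uw; apply: hw; rewrite inE uw orbT.
Qed.

Definition cursor_count (j : int) (n : nat) : nat :=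
  #|` fset_set [set x | word_ball n x /\ cursor x = j]|.

End LamplighterGroup.

Arguments std_gens F : clear implicits.
Arguments word_ball F n : clear implicits.

Section DirectionalGrowth.
Variables (R : realType) (F : finGroupType).

Definition spectrum (beta : R) : R :=
  limn (fun n : nat =>
    n%:R^-1 * ln (cursor_count F (Num.floor (beta * n%:R)) n)%:R).

Definition omega (r : nat) : R := (1 + Num.sqrt (1 + 4 * r%:R)) / 2.

Definition bar_beta (r : nat) : R := omega r ^+ 2 / (omega r ^+ 2 + r%:R).

Definition growth_defect (r : nat) (beta : R) : R :=
  ln (omega r) - spectrum beta.

End DirectionalGrowth.

(* Every subset of the lamplighter group is measurable, so the law of a random
   variable with values in it is defined on all subsets. *)
Definition uniform_on (R : realType) (F : finGroupType)
    (d : measure_display) (T : measurableType d) (P : probability T R)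
    (B : set (lamplighter F)) (Z : {RV P >-> lamplighter F}) : Prop :=
  forall A : set (lamplighter F),
    distribution P Z A
    = (#|` fset_set (A `&` B)|%:R / #|` fset_set B|%:R)%:E.

(* Main.v *)
(* A word for (eta, j) travels over a hull [-A, B] of the support containing 0
   and j, hence |(eta, j)| >= #supp eta + 2 (A + B) - |j|, and for 0 <= j with
   support in [0, j) the word sweeping from 0 to j has length #supp eta + j.
   Weighting each lit lamp by a tilt z in (0, 1] such that z^2 (1 + r z) <= 1
   (so that enlarging the hull does not pay) gives
     N_j(n) <= (n + 1)^2 (1 + r z) z^(-n) (z + r z^2)^|j|,
   while the sweeping words give N_j(n) >= 'C(j, n - j) r^(n - j).  For beta near
   bar_beta the optimal tilt is z = (1 - beta) / (r (2 beta - 1)), the two bounds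
   have the same exponential rate, and thus I(beta) is
     beta ln beta - (1 - beta) ln (1 - beta) - (2 beta - 1) ln (2 beta - 1)
       + (1 - beta) ln r,
   whose value, slope and second derivative at bar_beta are ln omega, 0 and
   -(1 + 4 r)^(3/2) / r.  The tail estimate is the Chernoff bound with the tilt
   of bar_beta +- s, which is below 1 / omega on the right of bar_beta and above
   it on the left, divided by |B(n)| >= omega^(n - 1). *)
Require Import Defs.
From HB Require Import structures.
From mathcomp Require Import all_boot all_order all_algebra all_fingroup finmap.
From mathcomp Require Import all_classical all_reals all_analysis.
From mathcomp Require Import zify ring lra.

Set Implicit Arguments.
Unset Strict Implicit.
Unset Printing Implicit Defensive.

Import Order.TTheory GRing.Theory Num.Theory.
Import numFieldNormedType.Exports.

Local Open Scope classical_set_scope.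
Local Open Scope ring_scope.

(** * Counting elements by cursor position *)

Definition num_lit (F : finGroupType) (N : nat) (f : {ffun 'I_N -> F}) : nat :=
  (\sum_(i < N) (f i != 1%g))%N.

Lemma card_nontrivial (F : finGroupType) (r : nat) :
  #|F| = r.+1 -> #|[pred c : F | c != 1%g]| = r.
Proof.
move=> cF; apply/eqP; rewrite -eqSS -cF -cardsT (cardsD1 1%g) inE add1n eqSS.
by apply/eqP; apply: eq_card => c; rewrite !inE andbT.
Qed.

(** Markov's inequality for the weight [z ^+ num_lit f]: over all [f] these weights sum to
    [(1 + r%:R * z) ^+ N], and each [f] with at most [k] lit lamps weighs at least [z ^+ k]. *)
Lemma card_num_lit_upper (R : realFieldType) (F : finGroupType) (r N k : nat)
    (z : R) : #|F| = r.+1 -> 0 <= z -> z <= 1 ->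
  #|[pred f : {ffun 'I_N -> F} | (num_lit f <= k)%N]|%:R * z ^+ k
    <= (1 + r%:R * z) ^+ N.
Proof.
move=> cF z0 z1.
have sumz : \sum_(c : F) z ^+ (c != 1%g) = 1 + r%:R * z.
  rewrite (bigD1 1%g)//= eqxx expr0; congr (_ + _).
  under eq_bigr => c c1 do rewrite c1 expr1.
  by rewrite sumr_const (card_nontrivial cF) mulr_natl.
have -> : (1 + r%:R * z) ^+ N = \prod_(i < N) \sum_(c : F) z ^+ (c != 1%g).
  by rewrite prodr_const card_ord sumz.
rewrite bigA_distr_bigA /=.
under eq_bigr => f _ do rewrite prodrXr.
rewrite (bigID (fun f => (num_lit f <= k)%N)) /= -[leLHS]addr0 lerD//.
  rewrite mulr_natl -sumr_const big_mkcond [leRHS]big_mkcond ler_sum// => f _.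
  by rewrite inE; case: ifP => // lek; rewrite ler_wiXn2l.
by apply: sumr_ge0 => f _; exact: exprn_ge0.
Qed.

(** It suffices to count exactly [k] lit lamps: choose their sites, then one of [r] nontrivial
    values at each. *)
Lemma card_num_lit_lower (F : finGroupType) (r N k : nat) : #|F| = r.+1 ->
  ('C(N, k) * r ^ k <= #|[pred f : {ffun 'I_N -> F} | (num_lit f <= k)%N]|)%N.
Proof.
move=> cF; rewrite -{1}[N]card_ord -card_draws.
rewrite -sum1dep_card big_distrl /=.
rewrite (eq_bigr (fun A : {set 'I_N} =>
    #|pffun_on 1%g (mem A) [pred c : F | c != 1%g]|)); last first.
  by move=> A /eqP cA; rewrite card_pffun_on (card_nontrivial cF) cA mul1n.
rewrite -[leqRHS]sum1_card.
pose supp (f : {ffun 'I_N -> F}) := [set i | f i != 1%g]%SET.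
have num_litE f : num_lit f = #|supp f|.
  by rewrite /num_lit -sum1dep_card [RHS]big_mkcond; apply: eq_bigr => i _; case: ifP.
rewrite [leqRHS](bigID (fun f => num_lit f == k)) /=; apply: leq_trans (leq_addr _ _).
rewrite (eq_bigl (fun f => num_lit f == k)); last first.
  by move=> f /=; rewrite inE; case: eqP => [->|]; rewrite ?leqnn ?andbF.
rewrite [leqRHS](partition_big supp (fun A => #|A| == k)) /=; last first.
  by move=> f; rewrite num_litE.
apply: leq_sum => A /eqP cA; rewrite -sum1_card.
rewrite [leqLHS]big_mkcond [leqRHS]big_mkcond; apply: leq_sum => f _.
case: ifP => // /pffun_onP[sfA fA].
suff sE : supp f = A by rewrite num_litE sE cA !eqxx.
apply/setP => i; rewrite inE; apply/idP/idP => [fi|iA].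
  by apply: (fintype.subsetP sfA); rewrite inE.
by have /fA : f i \in [seq f x | x in A] by apply: map_f; rewrite mem_enum.
Qed.

(** * Words, their hulls, and the upper bound at a given cursor *)

Lemma prod_rcons (F : finGroupType) (w : seq (lamplighter F)) s :
  (\prod_(u <- rcons w s) u)%g = ll_mul (\prod_(u <- w) u)%g s.
Proof. by rewrite -cats1 big_cat big_seq1. Qed.

Lemma ll_mul_t (F : finGroupType) (x : lamplighter F) :
  ll_mul x (ll_t F) = (x.1, x.2 + 1).
Proof.
congr pair => //=; apply/fsfunP => i.
by rewrite config_mulE config_shiftE config1E mulg1.
Qed.

Lemma ll_mul_tV (F : finGroupType) (x : lamplighter F) :
  ll_mul x ((ll_t F)^-1)%g = (x.1, x.2 - 1).
Proof.
congr pair => //=; apply/fsfunP => i.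
by rewrite config_mulE !config_shiftE config_invE config1E invg1 mulg1.
Qed.

Lemma ll_mul_lamp (F : finGroupType) (x : lamplighter F) c :
  ll_mul x (ll_lamp c) = (config_mul x.1 (config_shift x.2 (config_single c)), x.2).
Proof. by congr pair; rewrite /= addr0. Qed.

Lemma config_mul_singleE (F : finGroupType) (f : config F) j c i :
  config_mul f (config_shift j (config_single c)) i =
  (f i * (if i == j then c else 1))%g.
Proof. by rewrite config_mulE config_shiftE config_singleE subr_eq0. Qed.

(* Induction on the word, appending letters on the right: only a step that
   leaves the hull [-A, B] enlarges it, and then |j| grows with it. *)
Lemma word_footprint (F : finGroupType) (w : seq (lamplighter F)) x :
  is_word_of x w ->
  exists A B : nat, [/\ - A%:Z <= x.2, x.2 <= B%:Z,
    forall i, x.1 i != 1%g -> - A%:Z <= i <= B%:Z &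
    (#|` finsupp x.1| + 2 * (A + B) <= size w + `|x.2|)%N].
Proof.
elim/last_ind: w x => [|w s IHw] x [ws <-].
  exists 0, 0; rewrite big_nil; split => //= [i|].
    by rewrite config1E eqxx.
  rewrite !addn0 leqn0 cardfs_eq0; apply/eqP/fsetP => i.
  by rewrite mem_finsupp config1E eqxx inE.
have /IHw[A [B [hA hB hs hl]]] : is_word_of (\prod_(s <- w) s)%g w.
  by split=> // u uw; apply: ws; rewrite mem_rcons inE uw orbT.
rewrite size_rcons prod_rcons.
move: (\prod_(s <- w) s)%g hA hB hs hl => y hA hB hs hl.
have [[->|->]|[c c1 <-]] : std_gens F s by apply: ws; rewrite mem_rcons mem_head.
- rewrite ll_mul_t; case: y hA hB hs hl => f j /= hA hB hs hl; have [jB|jB] := ltP j B%:Z.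
    by exists A, B; split ; do ?lia; exact: hs.
  by exists A, B.+1; split; do ?lia; move=> i /hs; lia.
- rewrite ll_mul_tV; case: y hA hB hs hl => f j /= hA hB hs hl; have [jA|jA] := ltP (- A%:Z) j.
    by exists A, B; split ; do ?lia; exact: hs.
  by exists A.+1, B; split; do ?lia; move=> i /hs; lia.
- rewrite ll_mul_lamp /=; exists A, B; split => //= [i|].
    rewrite config_mul_singleE.
    by case: (i =P y.2) => [-> _|_]; [rewrite hA hB | rewrite mulg1; exact: hs].
  suff h : (#|` finsupp (config_mul y.1 (config_shift y.2 (config_single c)))|
    <= #|` finsupp y.1|.+1)%N.
    by rewrite addSn; apply: leq_trans (leq_add h (leqnn _)) _; rewrite addSn ltnS.
  apply: (@leq_trans #|` (y.2 |` finsupp y.1)%fset|); last first.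
    by rewrite cardfsU1 -add1n leq_add2r leq_b1.
  apply: fsubset_leq_card; apply/fsubsetP => i.
  rewrite in_fset1U !mem_finsupp config_mul_singleE.
  by case: (i =P y.2) => //= _; rewrite mulg1.
Qed.

Lemma word_ballP (F : finGroupType) n (x : lamplighter F) :
  word_ball F n x <-> exists2 w, is_word_of x w & (size w <= n)%N.
Proof.
rewrite /word_ball /= /word_length; case: ex_minnP => m /asboolP[w hw sw] hm.
split => [mn|[v hv vn]]; first by exists w; rewrite ?sw.
by apply: leq_trans vn; apply: hm; apply/asboolP; exists v.
Qed.

Lemma word_ball_footprint (F : finGroupType) n (x : lamplighter F) :
  word_ball F n x -> exists A B : nat,
  [/\ ((A <= n) && (B <= n))%N, (`|x.2| <= n)%N, (`|x.2| <= A + B)%N,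
    forall i, x.1 i != 1%g -> - A%:Z <= i <= B%:Z &
    (#|` finsupp x.1| + 2 * (A + B) <= n + `|x.2|)%N].
Proof.
move=> /word_ballP[w /word_footprint[A [B [hA hB hs hl]]] wn].
exists A, B; move: hA hB hs hl; case: x => f j /= hA hB hs hl.
by split=> //; lia.
Qed.

(** A union bound that tolerates overlaps: the hull attached to an element is not unique. *)
Lemma size_le_sum (T : eqType) (I : finType) (c : I -> pred T) (s : seq T) :
  (forall x, x \in s -> exists i, c i x) ->
  (size s <= \sum_(i : I) size (seq.filter (c i) s))%N.
Proof.
elim: s => //= x s IHs h.
have /h[i0 ci0] : x \in x :: s by rewrite mem_head.
have {}/IHs IHs : forall y, y \in s -> exists i, c i y.
  by move=> y ys; apply: h; rewrite inE ys orbT.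
rewrite (bigD1 i0) //= ci0 /= addSn ltnS (leq_trans IHs)//.
rewrite (bigD1 i0) //= leq_add2l leq_sum// => i _.
by case: ifP => //= _; exact: leqnSn.
Qed.

(** [K] will be [n + |j|], a single budget shared by the travel [2 * (A + B)] and the lit lamps. *)
Definition in_box (F : finGroupType) (A B : nat) (j : int) (K : nat)
    (x : lamplighter F) : Prop :=
  [/\ x.2 = j, forall i, x.1 i != 1%g -> - A%:Z <= i <= B%:Z &
    (#|` finsupp x.1| + 2 * (A + B) <= K)%N].

(** With the cursor fixed, an element is determined by its lamps on [[-A, B]]; at most
    [K - 2 * (A + B)] of these [(A + B).+1] lamps are lit, so [card_num_lit_upper] applies. *)
Lemma size_box (R : realFieldType) (F : finGroupType) (r : nat) (z : R)
    A B j K (s : seq (lamplighter F)) :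
  #|F| = r.+1 -> 0 <= z -> z <= 1 -> uniq s ->
  (forall x, x \in s -> in_box A B j K x) ->
  (size s)%:R * z ^+ K <= (z ^+ 2) ^+ (A + B) * (1 + r%:R * z) ^+ (A + B).+1.
Proof.
move=> cF z0 z1 us sbox.
have [|ltK] := leqP (2 * (A + B)) K; last first.
  (* If the travel alone exceeds the budget, no element fits in the box. *)
  suff -> : s = [::] by rewrite mul0r mulr_ge0// exprn_ge0// ?exprn_ge0// addr_ge0// mulr_ge0.
  case: s us sbox => // x s _ /(_ x); rewrite mem_head => /(_ isT)[_ _].
  by move=> /(leq_trans (leq_addl _ _)); rewrite leqNgt ltK.
move=> leK; pose k := (K - 2 * (A + B))%N.
pose h (x : lamplighter F) : {ffun 'I_(A + B).+1 -> F} :=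
  [ffun i : 'I_(A + B).+1 => x.1 (i%:Z - A%:Z)].
rewrite -(subnK leK) -/k exprD exprM mulrA [leLHS]mulrC ler_wpM2l ?exprn_ge0//.
apply: le_trans (card_num_lit_upper _ k cF z0 z1).
rewrite ler_wpM2r ?exprn_ge0// ler_nat cardE -(size_map h).
apply: uniq_leq_size.
  rewrite map_inj_in_uniq// => x y /sbox[xj xs _] /sbox[yj ys _] hxy.
  rewrite [x]surjective_pairing [y]surjective_pairing xj yj; congr pair.
  apply/fsfunP => i.
  have [/andP[iA iB]|iAB] := boolP (- A%:Z <= i <= B%:Z).
    have iN : (absz (i + A%:Z)%R < (A + B).+1)%N by lia.
    have /(congr1 (fun f : {ffun _ -> _} => f (Ordinal iN))) := hxy.
    by rewrite !ffunE /=; have -> : Posz (absz (i + A%:Z)%R) - A%:Z = i by lia.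
  have [-> |/xs] := eqVneq (x.1 i) 1%g; last by rewrite (negbTE iAB).
  by have [-> //|/ys] := eqVneq (y.1 i) 1%g; rewrite (negbTE iAB).
move=> _ /mapP[x /sbox[_ xs xK] ->]; rewrite mem_enum inE.
have {xK} : (#|` finsupp x.1| <= k)%N by rewrite /k; move: xK; move: #|` _| => ? ?; lia.
apply: leq_trans; rewrite /num_lit -big_mkcond sum1dep_card cardE.
pose e (i : 'I_(A + B).+1) := i%:Z - A%:Z.
rewrite -(size_map e); apply: uniq_leq_size.
  rewrite map_inj_uniq ?enum_uniq// => a b /addIr [] ?; exact: val_inj.
move=> _ /mapP[i + ->]; rewrite mem_enum finset.inE ffunE => hi.
by rewrite mem_finsupp.
Qed.

Lemma finite_cursor (F : finGroupType) (j : int) (n : nat) :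
  finite_set [set x : lamplighter F | word_ball F n x /\ cursor x = j].
Proof. by apply: sub_finite_set (finite_word_ball F n) => x []. Qed.

Lemma cursor_count_upper (R : realFieldType) (F : finGroupType) (r : nat)
    (z : R) j n : #|F| = r.+1 -> 0 < z -> z ^+ 2 * (1 + r%:R * z) <= 1 ->
  (cursor_count F j n)%:R * z ^+ n
    <= n.+1%:R ^+ 2 * (1 + r%:R * z) * (z + r%:R * z ^+ 2) ^+ `|j|.
Proof.
move=> cF z0 hz.
have rz : 1 <= 1 + r%:R * z by rewrite lerDl mulr_ge0// ltW.
have z1 : z <= 1.
  have z2 : z ^+ 2 <= 1 by apply: le_trans hz; rewrite ler_peMr// exprn_ge0// ltW.
  by move: z2; rewrite expr_le1// ltW.
pose X : {fset lamplighter F} :=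
  fset_set [set x : lamplighter F | word_ball F n x /\ cursor x = j].
have XP x : x \in X -> word_ball F n x /\ x.2 = j.
  by rewrite in_fset_set; [rewrite inE | exact: finite_cursor].
pose K := (n + `|j|)%N.
pose c (p : 'I_n.+1 * 'I_n.+1) (x : lamplighter F) :=
  (`|j| <= p.1 + p.2)%N && `[< in_box p.1 p.2 j K x >].
have hcov x : x \in (X : seq _) -> exists p, c p x.
  move=> /XP[/word_ball_footprint[A [B [/andP[An Bn] jn jAB xs xK]]] xj].
  rewrite xj in jn jAB xK.
  exists (inord A, inord B); apply/andP; rewrite /= !inordK//.
  by split=> //; apply/asboolP.
have hsz p : (size (seq.filter (c p) X))%:R * z ^+ K
    <= (1 + r%:R * z) * (z ^+ 2 * (1 + r%:R * z)) ^+ `|j|.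
  have [jp|jp] := leqP `|j| (p.1 + p.2); last first.
    rewrite (eq_in_filter (a2 := pred0)).
      by rewrite filter_pred0 mul0r mulr_ge0 ?exprn_ge0 ?mulr_ge0 ?exprn_ge0//; lra.
    by move=> x _ /=; rewrite /c leqNgt jp.
  apply: le_trans (@size_box R F r z p.1 p.2 j K _ cF (ltW z0) z1 _ _) _.
  - exact: filter_uniq (fset_uniq X).
  - by move=> x; rewrite mem_filter => /andP[/andP[_ /asboolP]].
  (* The hull has one site more than its length, which leaves a spare factor [1 + r%:R * z]. The
     remaining base is at most 1, so its exponent may drop from [p.1 + p.2] to [|j|]. *)
  rewrite [X in _ * X]exprS mulrCA -exprMn; rewrite ler_wpM2l//; first by lra.
  by rewrite ler_wiXn2l// mulr_ge0// ?exprn_ge0//; lra.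
(* [K] exceeds [n] by [|j|]; multiplying by [z ^+ |j|] turns the base [z + r%:R * z ^+ 2] into the
   base [z ^+ 2 * (1 + r%:R * z)] of [hsz]. *)
rewrite -(ler_pM2r (exprn_gt0 `|j| z0)) -[leLHS]mulrA -exprD -/K.
have -> : n.+1%:R ^+ 2 * (1 + r%:R * z) * (z + r%:R * z ^+ 2) ^+ `|j| * z ^+ `|j| =
  \sum_(p : 'I_n.+1 * 'I_n.+1) (1 + r%:R * z) * (z ^+ 2 * (1 + r%:R * z)) ^+ `|j|.
  rewrite sumr_const card_prod !card_ord -[RHS]mulr_natl natrM expr2 -!mulrA.
  by do 3 congr (_ * _); rewrite -exprMn; congr (_ ^+ _); ring.
apply: le_trans (ler_sum _ (fun p _ => hsz p)).
rewrite -mulr_suml -natr_sum ler_wpM2r ?(exprn_ge0 _ (ltW z0))// ler_nat.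
exact: size_le_sum.
Qed.

(** * Sweeping words and the lower bound at a given cursor *)

Fixpoint lamp_word (F : finGroupType) (g : nat -> F) (N : nat) :
    seq (lamplighter F) :=
  if N is M.+1 then
    rcons (if g M == 1%g then lamp_word g M
           else rcons (lamp_word g M) (ll_lamp (g M))) (ll_t F)
  else [::].

Lemma lamp_word_gens (F : finGroupType) (g : nat -> F) N s :
  s \in lamp_word g N -> std_gens F s.
Proof.
elim: N => //= N IHN; rewrite mem_rcons inE => /orP[/eqP->|]; first by left; left.
case: eqP => // /eqP gN; rewrite mem_rcons inE => /orP[/eqP->|//].
by right; exists (g N).
Qed.

Lemma size_lamp_word (F : finGroupType) (g : nat -> F) N :
  size (lamp_word g N) = (N + \sum_(i < N) (g i != 1%g))%N.
Proof.
elim: N => [|N IHN]; first by rewrite big_ord0.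
rewrite big_ord_recr /= size_rcons fun_if size_rcons IHN.
by case: eqP => //=; lia.
Qed.

Lemma prod_lamp_word (F : finGroupType) (g : nat -> F) N :
  let x := (\prod_(s <- lamp_word g N) s)%g in
  x.2 = N%:Z /\ forall i : int, x.1 i = if (0 <= i < N%:Z) then g `|i|%N else 1%g.
Proof.
elim: N => [|N [IH2 IH1]] /=.
  rewrite big_nil; split=> // i; rewrite config1E; case: ifP => //; lia.
rewrite prod_rcons ll_mul_t; set y := bigop.body _ _ _.
have [y2 y1] : y.2 = N%:Z /\
    forall i : int, y.1 i = if (0 <= i < N.+1%:Z) then g `|i|%N else 1%g.
  rewrite /y; case: eqP => [gN|gN].
    split=> // i; rewrite IH1.
    case: ifP => iN; case: ifP => iN' //; first by lia.
    by have -> : `|i|%N = N by lia.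
  rewrite prod_rcons ll_mul_lamp; split=> // i.
  rewrite [LHS]config_mul_singleE IH1 IH2.
  have [->|iN] := eqVneq i N%:Z.
    rewrite ltxx andbF mul1g; case: ifP => //; lia.
  rewrite mulg1; case: ifP => iN1; case: ifP => iN2 //; lia.
split; first by rewrite [LHS]/= y2; lia.
by move=> i; rewrite -y1.
Qed.

(** The sweep for [f] takes [N] steps and one letter per lit lamp, and its final configuration
    displays [f] on the sites from 0 to [N - 1], so distinct [f] give distinct elements. *)
Lemma num_lit_le_cursor_count (F : finGroupType) (N k : nat) :
  (#|[pred f : {ffun 'I_N -> F} | (num_lit f <= k)%N]|
    <= cursor_count F N (N + k))%N.
Proof.
(* [lamp_word] reads a function on [nat], so [f] is extended by the identity outside ['I_N]. *)
pose g (f : {ffun 'I_N -> F}) (m : nat) := if insub m is Some i then f i else 1%g.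
have gE f (i : 'I_N) : g f i = f i by rewrite /g valK.
pose h f := (\prod_(s <- lamp_word (g f) N) s)%g.
rewrite cardE -(size_map h); apply: uniq_leq_size.
  rewrite map_inj_uniq ?enum_uniq// => f1 f2 hf; apply/ffunP => i.
  have [_ /(_ (i : nat)%:Z)] := prod_lamp_word (g f1) N.
  have [_ /(_ (i : nat)%:Z)] := prod_lamp_word (g f2) N.
  rewrite -/(h f1) -/(h f2) hf => ->; rewrite lez_nat ltz_nat ltn_ord /=.
  by rewrite !gE => ->.
move=> _ /mapP[f + ->]; rewrite mem_enum inE => fk.
rewrite in_fset_set; last exact: finite_cursor.
rewrite inE; split; last by have [] := prod_lamp_word (g f) N.
apply/word_ballP; exists (lamp_word (g f) N).
  by split=> //; exact: lamp_word_gens.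
rewrite size_lamp_word leq_add2l; apply: leq_trans fk.
by rewrite /num_lit leq_sum// => i _; rewrite gE.
Qed.

Lemma cursor_count_lower (F : finGroupType) (r j n : nat) :
  #|F| = r.+1 -> (j <= n)%N ->
  ('C(j, n - j) * r ^ (n - j) <= cursor_count F j n)%N.
Proof.
move=> cF jn; apply: leq_trans (card_num_lit_lower _ _ cF) _.
by rewrite -{2}(subnKC jn); exact: num_lit_le_cursor_count.
Qed.

(** * Comparing the ball with its cursor fibres *)

Lemma sum_cursor_count_le (F : finGroupType) (n : nat) :
  (\sum_(j < n.+1) cursor_count F j n <= #|` fset_set (word_ball F n)|)%N.
Proof.
pose X := fset_set (word_ball F n).
rewrite -[leqRHS](count_predT X).
pose c (j : 'I_n.+1) (x : lamplighter F) := x.2 == (j : nat)%:Z.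
apply: (@leq_trans (\sum_(j < n.+1) count (c j) X)).
  apply: leq_sum => j _; rewrite -size_filter; apply: uniq_leq_size => // x.
  rewrite in_fset_set; last exact: finite_cursor.
  rewrite inE => -[xB xj]; rewrite mem_filter /c; apply/andP; split; first exact/eqP.
  by rewrite in_fset_set ?inE//; exact: finite_word_ball.
elim: (X : seq _) => [|x s IHs] /=; first by rewrite big1.
rewrite big_split /= leq_add//.
have [[j xj]|nx] := pselect (exists j, c j x).
  rewrite (bigD1 j)//= xj big1 ?addn0// => i ij; rewrite /c.
  by case: eqP => // xi; move: xj ij; rewrite /c xi => /eqP[/val_inj->]; rewrite eqxx.
by rewrite big1// => i _; case: (boolP (c i x)) => // ci; case: nx; exists i.
Qed.

Lemma card_ball_setI_le (R : realDomainType) (F : finGroupType)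
    (A : set (lamplighter F)) (n : nat) (M : R) : 0 <= M ->
  (forall j : int, (exists x, A x /\ cursor x = j) ->
    (cursor_count F j n)%:R <= M) ->
  #|` fset_set (A `&` word_ball F n)|%:R <= 2 * n.+1%:R * M.
Proof.
move=> M0 hM.
have fin : finite_set (A `&` word_ball F n).
  by apply: sub_finite_set (finite_word_ball F n) => x [].
(* Cursors in the ball lie in [[-n, n]]; indexing them by sign and absolute value hits 0 twice,
   whence [2 * n.+1] indices. *)
pose sg (p : bool * 'I_n.+1) : int := if p.1 then - (p.2 : nat)%:Z else (p.2 : nat)%:Z.
pose c p (x : lamplighter F) := x.2 == sg p.
apply: le_trans (_ : (\sum_p size (seq.filter (c p)
    (fset_set (A `&` word_ball F n))))%:R <= _).
  rewrite ler_nat; apply: size_le_sum.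
  move=> x; rewrite in_fset_set// inE => -[_ /word_ball_footprint[_ [_ [_ xn _ _ _]]]].
  exists (x.2 < 0, inord `|x.2|%N); rewrite /c /sg /= inordK//; apply/eqP.
  by case: ifP; move: x.2 => j; lia.
have -> : 2 * n.+1%:R * M = \sum_(p : bool * 'I_n.+1) M.
  by rewrite sumr_const card_prod card_bool card_ord -[RHS]mulr_natl natrM.
rewrite natr_sum; apply: ler_sum => p _.
(* An empty fibre is covered by [0 <= M]; a nonempty one supplies the element of [A] that [hM] asks
   for. *)
have [->//|x0] := eqVneq (seq.filter (c p) (fset_set (A `&` word_ball F n))) [::].
have [x xin] : exists x, x \in seq.filter (c p) (fset_set (A `&` word_ball F n)).
  by case: (seq.filter _ _) x0 => // x s _; exists x; rewrite mem_head.
apply: (@le_trans _ _ (cursor_count F (sg p) n)%:R); last first.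
  apply: hM; exists x; move: xin; rewrite mem_filter => /andP[/eqP xp].
  by rewrite in_fset_set// inE => -[Ax _].
rewrite ler_nat; apply: uniq_leq_size; first exact: filter_uniq (fset_uniq _).
move=> y; rewrite mem_filter in_fset_set// => /andP[/eqP yp].
rewrite inE => -[_ yB].
by rewrite in_fset_set ?inE//; exact: finite_cursor.
Qed.

(** Pascal's rule along diagonals. The characteristic equation of this recurrence is
    [x ^ 2 = x + r], whose positive root is [omega]. *)
Lemma binomial_sum_rec (r n : nat) :
  (\sum_(j < n.+3) 'C(j, n.+2 - j) * r ^ (n.+2 - j) =
   \sum_(j < n.+2) 'C(j, n.+1 - j) * r ^ (n.+1 - j) +
   r * \sum_(j < n.+1) 'C(j, n - j) * r ^ (n - j))%N.
Proof.
(* The term [j = 0] on the left is ['C(0, n.+2) = 0], so that side can be reindexed by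
   [j = i.+1]. *)
rewrite big_ord_recl /= bin0n mul0n add0n big_distrr /=.
rewrite [in RHS]big_ord_recr /= big_ord_recr /= subnn !bin0 expn0.
rewrite addnAC -big_split /=; congr addn; last by rewrite subnn bin0.
apply: eq_bigr => i _; rewrite /bump /= add1n.
have -> : (n.+2 - i.+1 = (n - i).+1)%N by have := ltn_ord i; lia.
have -> : (n.+1 - i = (n - i).+1)%N by have := ltn_ord i; lia.
by rewrite binS expnS mulnDl [(r * (_ * _))%N]mulnCA.
Qed.

(** * The explicit spectrum near its maximum *)

Lemma is_derive_affine (R : realType) (a b x : R) :
  is_derive x 1 (fun y => a * y + b) a.
Proof.
have : is_derive x 1 (a *: (id : R -> R) + cst b) (a *: 1 + 0) by exact: is_deriveD.
by rewrite addr0 [a *: 1]mulr1.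
Qed.

Lemma is_derive_ln_affine (R : realType) (a b x : R) : 0 < a * x + b ->
  is_derive x 1 (fun y => ln (a * y + b)) (a / (a * x + b)).
Proof.
move=> h.
rewrite [a / _]mulrC.
by have := @is_derive1_comp R (@ln R) (fun y => a * y + b) x (a * x + b)^-1 a
  (is_derive1_ln h) (is_derive_affine a b x).
Qed.

(** A second-order Taylor bound from the differentiability of [df] at the single point [a]: once the
    quadratic is subtracted, the derivative is nonnegative just before [a] and nonpositive just
    after, and the mean value theorem concludes. *)
Lemma le_quadratic_near (R : realType) (f df : R -> R) (a D eps : R) :
  (\forall x \near a, is_derive (x : R) 1 f (df x)) -> df a = 0 ->
  is_derive a 1 df D -> 0 < eps ->
  \forall x \near a, f x <= f a + (D / 2 + eps) * (x - a) ^+ 2.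
Proof.
move=> fdf dfa [ddf Dval] eps0.
(* The derivative of the quadratic has slope [D + 2 * eps], so the difference quotient of [df] may
   be off by [2 * eps]. *)
have e20 : 0 < 2 * eps by rewrite mulr_gt0.
have /cvgrPdist_le/(_ _ e20)[d1 /= d10 hd1] :
    h^-1 *: (df (h *: 1 + a) - df a) @[h --> (0:R)^'] --> D.
  by rewrite -Dval; exact: ddf.
have [d2 /= d20 hd2] := fdf.
have slope y : `|y - a| < d1 -> y != a ->
    `|D - (y - a)^-1 * df y| <= 2 * eps.
  move=> ya yNa; have := hd1 (y - a); rewrite /= sub0r normrN => /(_ ya).
  by rewrite subr_eq0 => /(_ yNa); rewrite dfa subr0 [_%:A]mulr1 subrK.
exists (Num.min d1 d2) => /= [|x]; first by rewrite lt_min d10.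
rewrite /= lt_min distrC => /andP[x1 x2].
pose g y := f y - (D / 2 + eps) * (y - a) ^+ 2.
pose dg y := df y - (D + 2 * eps) * (y - a).
have gdg y : `|y - a| < d2 -> is_derive y 1 g (dg y).
  move=> ya; have fy : is_derive y 1 f (df y) by apply: hd2; rewrite /= distrC.
  have hsq : is_derive y 1 (fun u => (u - a) ^+ 2) (2 * (y - a)).
    have : is_derive y 1 (((id : R -> R) - cst a) ^+ 2)
        ((2%:R * (y - a) ^+ 1) *: (1 - 0)) by exact: is_deriveX.
    by rewrite subr0 expr1 [_ *: 1]mulr1.
  have : is_derive y 1 (f - (D / 2 + eps) *: (fun u => (u - a) ^+ 2))
      (df y - (D / 2 + eps) *: (2 * (y - a))) by exact: is_deriveB.
  suff -> : (D / 2 + eps) *: (2 * (y - a)) = (D + 2 * eps) * (y - a) by [].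
  by rewrite [LHS]mulrA; congr (_ * _); field.
suff : g x <= g a by rewrite /g subrr expr0n mulr0 subr0 => h; lra.
have [xa|ax|->//] := ltgtP x a.
- have [c||c xca hc] := @MVT _ g dg x a xa.
  + by rewrite in_itv/= => /andP[xc ca]; apply: gdg; move: x2; rewrite !ltr0_norm; lra.
  + apply: derivable_within_continuous => c; rewrite in_itv/= => /andP[xc ca].
    have [] // := gdg c; move: x2; rewrite !ler0_norm; lra.
  move: xca; rewrite in_itv/= => /andP[xc ca].
  have := @slope c; rewrite lt_eqF// => /(_ _ isT).
  have -> : `|c - a| < d1 by move: x1; rewrite !ltr0_norm; lra.
  move=> /(_ isT); rewrite ler_norml => /andP[h _].
  have : 0 <= dg c.
    rewrite /dg; have : (D + 2 * eps - (c - a)^-1 * df c) * (c - a) <= 0.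
      by apply: mulr_ge0_le0; lra.
    have := mulVf (_ : c - a != 0); rewrite subr_eq0 lt_eqF// => /(_ isT) hv hh.
    have : (c - a)^-1 * df c * (c - a) = df c by rewrite mulrAC hv mul1r.
    lra.
  move=> dgc; have : 0 <= dg c * (a - x) by apply: mulr_ge0 => //; lra.
  lra.
- have [c||c xca hc] := @MVT _ g dg a x ax.
  + by rewrite in_itv/= => /andP[xc ca]; apply: gdg; move: x2; rewrite !gtr0_norm; lra.
  + apply: derivable_within_continuous => c; rewrite in_itv/= => /andP[xc ca].
    have [] // := gdg c; move: x2; rewrite !ger0_norm; lra.
  move: xca; rewrite in_itv/= => /andP[xc ca].
  have := @slope c; rewrite gt_eqF// => /(_ _ isT).
  have -> : `|c - a| < d1 by move: x1; rewrite !gtr0_norm; lra.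
  move=> /(_ isT); rewrite ler_norml => /andP[h _].
  have : dg c <= 0.
    rewrite /dg; have : 0 <= (D + 2 * eps - (c - a)^-1 * df c) * (c - a).
      by apply: mulr_ge0; lra.
    have := mulVf (_ : c - a != 0); rewrite subr_eq0 gt_eqF// => /(_ isT) hv hh.
    have : (c - a)^-1 * df c * (c - a) = df c by rewrite mulrAC hv mul1r.
    lra.
  move=> dgc; have : dg c * (x - a) <= 0 by apply: mulr_le0_ge0 => //; lra.
  lra.
Qed.

(* T k is the largest of the N + 1 terms of the expansion of (k + (N - k))^N. *)
Lemma binomial_entropy (N k : nat) : (k <= N)%N ->
  (N ^ N <= 'C(N, k) * k ^ k * (N - k) ^ (N - k) * N.+1)%N.
Proof.
move=> kN; pose q := (N - k)%N.
pose T i := ('C(N, i) * (q ^ (N - i) * k ^ i))%N.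
(* A ratio test without division: thanks to the common factor [u], comparing [T i] with [T i.+1]
   reduces to comparing [i.+1 * q] with [(N - i) * k]. *)
have TS i : (i < N)%N -> exists u : nat,
    (i.+1 * T i = u * (i.+1 * q) /\ i.+1 * T i.+1 = u * ((N - i) * k))%N.
  move=> iN; exists ('C(N, i) * (q ^ (N - i.+1) * k ^ i))%N.
  split; first by rewrite /T -(subnSK iN) expnS; ring.
  by rewrite /T [(k ^ _)%N]expnS mulnA mul_bin_left; ring.
have up i : (i < k)%N -> (T i <= T i.+1)%N.
  move=> ik; have iN := leq_trans ik kN.
  have [u [e1 e2]] := TS i iN.
  rewrite -(leq_pmul2l (ltn0Sn i)) e1 e2 leq_mul2l [(_ * k)%N]mulnC leq_mul ?orbT//.
  by rewrite /q leq_sub2l// ltnW.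
have down i : (k <= i)%N -> (i < N)%N -> (T i.+1 <= T i)%N.
  move=> ki iN; have [u [e1 e2]] := TS i iN.
  rewrite -(leq_pmul2l (ltn0Sn i)) e1 e2 leq_mul2l mulnC leq_mul ?orbT//.
    exact: leqW.
  by rewrite /q leq_sub2l.
have Tmax i : (i <= N)%N -> (T i <= T k)%N.
  have [ki|ik _] := leqP k i.
    elim: i ki => [|i IHi]; first by rewrite leqn0 => /eqP ->.
    rewrite leq_eqVlt => /orP[/eqP->//|]; rewrite ltnS => ki iN.
    exact: leq_trans (down _ ki iN) (IHi ki (ltnW iN)).
  have /(_ k) : forall m, (i <= m)%N -> (m <= k)%N -> (T i <= T m)%N.
    elim=> [|m IHm]; first by rewrite leqn0 => /eqP ->.
    rewrite leq_eqVlt => /orP[/eqP->//|]; rewrite ltnS => im mk.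
    exact: leq_trans (IHm im (ltnW mk)) (up _ mk).
  by apply=> //; exact: ltnW.
rewrite -{1}(subnK kN) -/q expnDn.
apply: (@leq_trans (\sum_(i < N.+1) T k)%N).
  by apply: leq_sum => i _; apply: Tmax; rewrite -ltnS.
rewrite sum_nat_const card_ord /T -/q; apply: eq_leq; ring.
Qed.

Definition rate (R : realType) (r : nat) (x : R) : R :=
  x * ln x - (1 - x) * ln (1 - x) - (2 * x - 1) * ln (2 * x - 1)
  + (1 - x) * ln r%:R.

Definition drate (R : realType) (r : nat) (x : R) : R :=
  ln x + ln (1 - x) - 2 * ln (2 * x - 1) - ln r%:R.

(* The solution z of r z / (1 + r z) = (1 - x) / x, the density of lit lamps of
   an element at cursor x n whose length n is attained without excess travel. *)
Definition tilt (R : realType) (r : nat) (x : R) : R :=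
  (1 - x) / (r%:R * (2 * x - 1)).

Lemma is_derive_xlnx_affine (R : realType) (a b x : R) : 0 < a * x + b ->
  is_derive x 1 (fun y => (a * y + b) * ln (a * y + b)) (a * (1 + ln (a * x + b))).
Proof.
move=> h.
have h1 := is_derive_affine a b x.
have h2 := is_derive_ln_affine h.
have := @is_deriveM _ _ _ _ _ _ _ _ h1 h2.
suff -> : (a * x + b) *: (a / (a * x + b)) + ln (a * x + b) *: a =
  a * (1 + ln (a * x + b)) by [].
rewrite [LHS](_ : _ = (a * x + b) * (a / (a * x + b)) + ln (a * x + b) * a)//.
by field; rewrite gt_eqF.
Qed.

(** * Derivatives of [rate], closed forms at [bar_beta], and the tilted count *)

Section Spectrum.
Variables (R : realType) (r : nat).
Hypothesis r_gt0 : (1 <= r)%N.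
Implicit Types x : R.

Let r0 : 0 < r%:R :> R. Proof. by rewrite ltr0n. Qed.

Lemma is_derive_rate x : 1 / 2 < x -> x < 1 -> is_derive x 1 (rate r) (drate r x).
Proof.
move=> x1 x2.
have h1 : is_derive x 1 (fun y : R => (1 * y + 0) * ln (1 * y + 0)) _ :=
  is_derive_xlnx_affine (ltac:(lra) : 0 < 1 * x + 0).
have h2 : is_derive x 1 (fun y : R => (- 1 * y + 1) * ln (- 1 * y + 1)) _ :=
  is_derive_xlnx_affine (ltac:(lra) : 0 < - 1 * x + 1).
have h3 : is_derive x 1 (fun y : R => (2 * y - 1) * ln (2 * y - 1)) _ :=
  is_derive_xlnx_affine (ltac:(lra) : 0 < 2 * x - 1).
have h4 := is_derive_affine (- ln r%:R) (ln r%:R) x.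
have := is_deriveD (is_deriveB (is_deriveB h1 h2) h3) h4.
congr is_derive.
  by apply/funext => y; rewrite /rate !fctE !mul1r !mulN1r !addr0 [- y + 1]addrC; ring.
rewrite /drate !mul1r !mulN1r !addr0 [- x + 1]addrC; ring.
Qed.

Lemma is_derive_drate x : 1 / 2 < x -> x < 1 ->
  is_derive x 1 (drate r) (1 / x - 1 / (1 - x) - 4 / (2 * x - 1)).
Proof.
move=> x1 x2.
have h1 : is_derive x 1 (fun y : R => ln (1 * y + 0)) _ :=
  is_derive_ln_affine (ltac:(lra) : 0 < 1 * x + 0).
have h2 : is_derive x 1 (fun y : R => ln (- 1 * y + 1)) _ :=
  is_derive_ln_affine (ltac:(lra) : 0 < - 1 * x + 1).
have h3 : is_derive x 1 (fun y : R => ln (2 * y - 1)) _ :=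
  is_derive_ln_affine (ltac:(lra) : 0 < 2 * x - 1).
have h4 := is_derive_affine 0 (- ln r%:R) x.
have := is_deriveD (is_deriveB (is_deriveD h1 h2) (is_deriveD h3 h3)) h4.
congr is_derive.
  by apply/funext => y; rewrite /drate !fctE !mul1r !mulN1r !addr0 [- y + 1]addrC; ring.
rewrite !mul1r !mulN1r !addr0 [- x + 1]addrC; field.
by apply/and3P; split; rewrite gt_eqF//; lra.
Qed.

Lemma tilt_gt0 x : 1 / 2 < x -> x < 1 -> 0 < tilt r x.
Proof. by move=> x1 x2; rewrite divr_gt0 ?mulr_gt0//; lra. Qed.

Lemma tilt1E x : 1 / 2 < x -> 1 + r%:R * tilt r x = x / (2 * x - 1).
Proof. by move=> x1; rewrite /tilt; field; rewrite !gt_eqF//; lra. Qed.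

(** The right side is the exponent per letter of the tilted upper bound at cursor [x n]; with the
    tilt [tilt r x] it meets the exponent [rate r x] of the binomial lower bound. *)
Lemma rate_tiltE x : 1 / 2 < x -> x < 1 ->
  rate r x = - ln (tilt r x) + x * ln (tilt r x + r%:R * tilt r x ^+ 2).
Proof.
move=> x1 x2; have z0 := tilt_gt0 x1 x2.
have -> : tilt r x + r%:R * tilt r x ^+ 2 = tilt r x * (1 + r%:R * tilt r x) by ring.
have x0 : 0 < x by lra.
have y0 : 0 < 1 - x by lra.
have t0 : 0 < 2 * x - 1 by lra.
have rt0 : 0 < r%:R * (2 * x - 1) by exact: mulr_gt0.
rewrite tilt1E// lnM ?posrE ?divr_gt0//.
rewrite /tilt !ln_div ?posrE ?mulr_gt0// lnM ?posrE//.
rewrite /rate; ring.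
Qed.

Let s : R := Num.sqrt (1 + 4 * r%:R).
Let w : R := omega R r.
Let b : R := bar_beta R r.

Lemma sqrt_disc_gt2 : 2 < s.
Proof.
have r1 : 1 <= r%:R :> R by rewrite ler1n.
rewrite -(@ltr_pXn2r _ 2)// ?nnegrE ?sqrtr_ge0//.
by rewrite sqr_sqrtr; lra.
Qed.

Lemma sqrt_disc_sq : s ^+ 2 = 1 + 4 * r%:R.
Proof. by rewrite sqr_sqrtr// addr_ge0// mulr_ge0// ltW. Qed.

Lemma omegaE : w = (1 + s) / 2. Proof. by []. Qed.

Lemma omega_sq : w ^+ 2 = w + r%:R.
Proof. by have := sqrt_disc_sq; rewrite omegaE; lra. Qed.

Lemma omega_gt1 : 1 < w.
Proof. by rewrite omegaE; have := sqrt_disc_gt2; lra. Qed.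

Lemma natrE_omega : r%:R = w * (w - 1).
Proof. by have := omega_sq; lra. Qed.

(** Since [r = w * (w - 1)] and [s = 2 * w - 1], the denominator [w ^ 2 + r] equals [w * s]. *)
Lemma bar_betaE : b = w / s.
Proof.
have h1 := omega_gt1; have h2 := sqrt_disc_gt2.
rewrite /b /bar_beta -/w natrE_omega.
have -> : s = 2 * w - 1 by rewrite omegaE; lra.
field; apply/andP; split; rewrite gt_eqF//; nra.
Qed.

Lemma bar_beta_gt : 1 / 2 < b.
Proof.
have h2 := sqrt_disc_gt2.
by rewrite bar_betaE ltr_pdivlMr; [rewrite omegaE|]; lra.
Qed.

Lemma bar_beta_lt : b < 1.
Proof.
have h2 := sqrt_disc_gt2.
by rewrite bar_betaE ltr_pdivrMr; [rewrite omegaE|]; lra.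
Qed.

Lemma onem_bar_beta : 1 - b = (w - 1) / s.
Proof.
have h2 := sqrt_disc_gt2; rewrite bar_betaE omegaE; field.
by rewrite gt_eqF//; lra.
Qed.

Lemma two_bar_beta : 2 * b - 1 = 1 / s.
Proof.
have h2 := sqrt_disc_gt2; rewrite bar_betaE omegaE; field.
by rewrite gt_eqF//; lra.
Qed.

Lemma tilt_bar_beta : tilt r b = w^-1.
Proof.
have h1 := omega_gt1; have h2 := sqrt_disc_gt2.
rewrite /tilt onem_bar_beta two_bar_beta natrE_omega; field.
by apply/and3P; split; rewrite gt_eqF//; lra.
Qed.

Lemma rate_bar_beta : rate r b = ln w.
Proof.
have h1 := omega_gt1.
rewrite rate_tiltE ?bar_beta_gt ?bar_beta_lt// tilt_bar_beta natrE_omega.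
(* The weight of a cursor step is 1 at the tilt [w^-1], so only [- ln z] survives in the rate. *)
have -> : w^-1 + w * (w - 1) * w^-1 ^+ 2 = 1 by field; rewrite gt_eqF//; lra.
by rewrite ln1 lnV ?posrE ?opprK; lra.
Qed.

Lemma drate_bar_beta : drate r b = 0.
Proof.
have h1 := omega_gt1; have h2 := sqrt_disc_gt2.
rewrite /drate two_bar_beta onem_bar_beta bar_betaE natrE_omega div1r.
have w0 : 0 < w by lra.
have w10 : 0 < w - 1 by lra.
have s0 : 0 < s by lra.
rewrite lnV ?posrE// [ln (w / s)]ln_div ?posrE// [ln ((w - 1) / s)]ln_div ?posrE//.
by rewrite [ln (w * _)]lnM ?posrE//; ring.
Qed.

Lemma ddrate_bar_beta :
  1 / b - 1 / (1 - b) - 4 / (2 * b - 1) = - (s ^+ 3 / r%:R).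
Proof.
have h1 := omega_gt1; have h2 := sqrt_disc_gt2.
rewrite two_bar_beta onem_bar_beta bar_betaE natrE_omega.
have -> : s = 2 * w - 1 by rewrite omegaE; lra.
by field; rewrite !gt_eqF//; lra.
Qed.

(** At [b] the tilt is [w^-1] and the left side of the last condition is [w^-1 < 1]; strict
    inequalities persist nearby. *)
Lemma tilt_near : \forall x \near b,
  [/\ 1 / 2 < x, x < 1 & tilt r x ^+ 2 * (1 + r%:R * tilt r x) <= 1].
Proof.
have h1 := omega_gt1; have h2 := sqrt_disc_gt2.
(* The same strict inequality with denominators cleared, so that only the continuity of a polynomial
   is involved. *)
have hb : 0 < r%:R ^+ 2 * (2 * b - 1) ^+ 3 - (1 - b) ^+ 2 * b.
  rewrite two_bar_beta onem_bar_beta bar_betaE natrE_omega.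
  have -> : (w * (w - 1)) ^+ 2 * (1 / s) ^+ 3 - ((w - 1) / s) ^+ 2 * (w / s) =
     (w - 1) ^+ 3 * w * s^-1 ^+ 3 by field; rewrite gt_eqF//; lra.
  by rewrite !mulr_gt0 ?exprn_gt0 ?invr_gt0//; lra.
have cont : {for b, continuous (fun x : R =>
    r%:R ^+ 2 * (2 * x - 1) ^+ 3 - (1 - x) ^+ 2 * x)}.
  rewrite (_ : (fun x : R => _) = horner
     ((r%:R ^+ 2)%:P * (2%:P * 'X - 1) ^+ 3 - (1 - 'X) ^+ 2 * 'X)); last first.
    by apply/funext => x; rewrite !hornerE.
  exact: continuous_horner.
have b1 := bar_beta_gt; have b2 := bar_beta_lt.
near=> x.
have x1 : 1 / 2 < x by near: x; exact: lt_nbhsr.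
have x2 : x < 1 by near: x; exact: lt_nbhsl.
split=> //.
have hx : 0 < r%:R ^+ 2 * (2 * x - 1) ^+ 3 - (1 - x) ^+ 2 * x.
  by near: x; apply: (cvgr_gt _ cont).
rewrite tilt1E// /tilt.
have -> : ((1 - x) / (r%:R * (2 * x - 1))) ^+ 2 * (x / (2 * x - 1)) =
  ((1 - x) ^+ 2 * x) / (r%:R ^+ 2 * (2 * x - 1) ^+ 3).
  by field; rewrite !gt_eqF//; lra.
rewrite ler_pdivrMr; first by lra.
by rewrite mulr_gt0 ?exprn_gt0//; lra.
Unshelve. all: by end_near. Qed.

(** The numerator vanishes at [w / s = b] and at [(w - 1) / s = 1 - b < 1 / 2]; beyond [1 / 2] the
    weight of a cursor step therefore crosses 1 only at [b]. *)
Lemma tilt_cost x : 1 / 2 < x ->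
  tilt r x + r%:R * tilt r x ^+ 2 - 1 =
  - ((s * x - w) * (s * x - (w - 1))) / (r%:R * (2 * x - 1) ^+ 2).
Proof.
move=> x1; have h2 := sqrt_disc_gt2.
have -> : (s * x - w) * (s * x - (w - 1)) = (1 + 4 * r%:R) * (x ^+ 2 - x) + r%:R.
  by rewrite -sqrt_disc_sq natrE_omega omegaE; field.
by rewrite /tilt; field; rewrite !gt_eqF//; lra.
Qed.

Lemma tilt_cost_le1 x : b <= x -> tilt r x + r%:R * tilt r x ^+ 2 <= 1.
Proof.
move=> bx; have b1 := bar_beta_gt; have h2 := sqrt_disc_gt2.
have x1 : 1 / 2 < x by lra.
rewrite -subr_le0 tilt_cost//.
rewrite mulr_le0_ge0//; last by rewrite invr_ge0 mulr_ge0 ?sqr_ge0// ltW.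
have : w <= s * x by move: bx; rewrite bar_betaE ler_pdivrMr; lra.
by move=> h; rewrite oppr_le0 mulr_ge0//; lra.
Qed.

Lemma tilt_cost_ge1 x : 1 / 2 < x -> x <= b -> 1 <= tilt r x + r%:R * tilt r x ^+ 2.
Proof.
move=> x1 bx; have h2 := sqrt_disc_gt2.
rewrite -subr_ge0 tilt_cost//.
rewrite mulr_ge0//; last by rewrite invr_ge0 mulr_ge0 ?sqr_ge0// ltW.
have : s * x <= w by move: bx; rewrite bar_betaE ler_pdivlMr; lra.
have : 1 / 2 * s <= x * s by rewrite ler_wpM2r//; lra.
move=> h h'; rewrite oppr_ge0 mulr_le0_ge0//; first by lra.
by rewrite omegaE; lra.
Qed.

(** The upper bound depends on [j] through [y ^+ |j|], where [y <= 1] to the right of [b] and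
    [y >= 1] to the left. On either side, replacing [|j|] by [x n] only enlarges it, so a single
    tilt serves a whole tail. *)
Lemma tilted_count (F : finGroupType) x (j : int) n : #|F| = r.+1 ->
  1 / 2 < x -> x < 1 -> tilt r x ^+ 2 * (1 + r%:R * tilt r x) <= 1 ->
  (b <= x /\ x * n%:R <= `|j|%N%:R) \/ (x <= b /\ `|j|%N%:R <= x * n%:R) ->
  (cursor_count F j n)%:R <= n.+1%:R ^+ 2 * (1 + r%:R) * expR (n%:R * rate r x).
Proof.
move=> cF x1 x2 hz hj; have z0 := tilt_gt0 x1 x2.
set z := tilt r x in hz z0 *.
have z1 : z <= 1.
  have : z ^+ 2 <= 1.
    by apply: le_trans hz; rewrite ler_peMr ?sqr_ge0// lerDl mulr_ge0// ltW.
  by rewrite expr_le1// ltW.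
have y0 : 0 < z + r%:R * z ^+ 2 by rewrite addr_gt0// mulr_gt0 ?exprn_gt0.
rewrite -(ler_pM2r (exprn_gt0 n z0)).
apply: le_trans (cursor_count_upper j n cF z0 hz) _.
rewrite -[leRHS]mulrA; apply: ler_pM.
- by rewrite mulr_ge0 ?sqr_ge0// addr_ge0// mulr_ge0// ltW.
- exact/exprn_ge0/ltW.
- by rewrite ler_wpM2l ?sqr_ge0// lerD2l ler_piMr.
set y := z + _ in y0 *.
rewrite -[in leLHS](@lnK _ y)// -expRM_natl -[z ^+ n](@lnK _ (z ^+ n)) ?posrE ?exprn_gt0//.
rewrite -expRD ler_expR lnXn// -[X in _ + X]mulr_natl rate_tiltE// -/z -/y mulrDr.
(* The powers of [z] cancel, and what remains is to compare [|j| * ln y] with [x * n * ln y]. *)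
have -> : n%:R * - ln z + n%:R * (x * ln y) + n%:R * ln z = (x * n%:R) * ln y by ring.
case: hj => -[bx hj].
  by rewrite ler_wnM2r// ln_le0// tilt_cost_le1.
by rewrite ler_wpM2r// ln_ge0// tilt_cost_ge1.
Qed.

End Spectrum.

(** * The limit and the deviation bound *)

(** With [q = sqrt (n + 1)] and [n >= 1], one has [ln (n + 1) = 2 ln q < 2 q <= 4 n / q]. *)
Lemma cvg_ln_div (R : realType) :
  (fun n : nat => ln n.+1%:R / n%:R : R) @ \oo --> (0 : R).
Proof.
have h : (fun n : nat => 4 * Num.sqrt (harmonic n) : R) @ \oo --> (0 : R).
  rewrite -[0 in X in _ --> X](mulr0 4); apply: cvgMr.
  rewrite -[0 in X in _ --> X](sqrtr0 R).
  exact: (cvg_comp _ _ cvg_harmonic (@sqrt_continuous R 0)).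
apply: (@squeeze_cvgr _ _ _ _ (cst 0) _ _ _ 0 _ h); last exact: cvg_cst.
near=> n; have n0 : (0 < n)%N by near: n; exists 1%N.
have n0R : 1 <= n%:R :> R by rewrite ler1n.
rewrite /= divr_ge0 ?ln_ge0 ?ler1n//= ler_pdivrMr ?ltr0n//.
set q : R := Num.sqrt n.+1%:R.
have q0 : 0 < q by rewrite sqrtr_gt0 ltr0n.
have qq : q ^+ 2 = n.+1%:R by rewrite sqr_sqrtr.
have -> : Num.sqrt (harmonic n) = q^-1 :> R by rewrite /harmonic /= sqrtrV.
rewrite -qq lnXn// -(mulr_natl (ln _)).
have := ln_sublinear q0 => lnq.
have : q <= 2 * (n%:R / q).
  rewrite mulrA ler_pdivlMr// -expr2 qq -natr1; lra.
have e : 4 * q^-1 * n%:R = 2 * (2 * (n%:R / q)) by ring.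
by move=> qn; rewrite [leRHS]e; lra.
Unshelve. all: by end_near. Qed.

Lemma cvg_cst_div (R : realType) (c : R) :
  (fun n : nat => c / n%:R : R) @ \oo --> (0 : R).
Proof.
rewrite -[0 in X in _ --> X](mulr0 c); apply: cvgMr.
apply/gtr0_cvgV0; last exact: cvgr_idn.
by exists 1%N => // n /= n0; rewrite ltr0n.
Qed.

Lemma cvg_floor_div (R : realType) (x : R) : 0 <= x ->
  (fun n : nat => `|Num.floor (x * n%:R)|%N%:R / n%:R : R) @ \oo --> x.
Proof.
move=> x0.
have h : (fun n : nat => x - 1 / n%:R : R) @ \oo --> x.
  rewrite -[x in X in _ --> X]subr0; apply: cvgB; first exact: cvg_cst.
  exact: cvg_cst_div.
apply: (@squeeze_cvgr _ _ _ _ _ (cst x) _ _ x h); last exact: cvg_cst.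
near=> n; have n0 : (0 < n)%N by near: n; exists 1%N.
have n0R : 0 < n%:R :> R by rewrite ltr0n.
have xn0 : 0 <= x * n%:R by rewrite mulr_ge0.
have f0 : 0 <= Num.floor (x * n%:R) by rewrite floor_ge0.
have -> : `|Num.floor (x * n%:R)|%N%:R = (Num.floor (x * n%:R))%:~R :> R.
  by rewrite natr_absz ger0_norm.
rewrite /= ler_pdivrMr// floor_le andbT ler_pdivlMr// mulrBl divfK ?gt_eqF//.
have := floorD1_gt (x * n%:R); rewrite intrD; lra.
Unshelve. all: by end_near. Qed.

(** * The spectrum as the common limit of the two bounds *)

Section SpectrumValue.
Variables (R : realType) (r : nat) (F : finGroupType).
Hypotheses (r_gt0 : (1 <= r)%N) (card_F : #|F| = r.+1).

(** The condition [n - j <= j] keeps ['C(j, n - j)] positive, which allows taking the logarithm of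
    the count. *)
Lemma cursor_count_gt0 (j n : nat) : (j <= n)%N -> (n <= 2 * j)%N ->
  (0 < cursor_count F j n)%N.
Proof.
move=> jn nj; apply: leq_trans (cursor_count_lower card_F jn).
by rewrite muln_gt0 bin_gt0 expn_gt0 r_gt0 andbT; lia.
Qed.

(** This is [binomial_entropy] for ['C(j, k)] with [k = n - j]; the terms in [ln n] cancel from
    [n * rate] because [j = k + (j - k)]. *)
Lemma ln_cursor_count_lower (j n : nat) :
  1 / 2 < j%:R / n%:R :> R -> j%:R / n%:R < 1 :> R ->
  n%:R * rate r (j%:R / n%:R) - ln n.+1%:R <= ln (cursor_count F j n)%:R :> R.
Proof.
move=> h1 h2.
have n0 : (0 < n)%N.
  by rewrite lt0n; apply/eqP => n0; move: h1; rewrite n0 invr0 mulr0; lra.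
have n0R : 0 < n%:R :> R by rewrite ltr0n.
have r0R : 0 < r%:R :> R by rewrite ltr0n.
have jn : (j < n)%N by move: h2; rewrite ltr_pdivrMr// mul1r ltr_nat.
have nj : (n < 2 * j)%N.
  by move: h1; rewrite ltr_pdivlMr// -(@ltr_nat R) natrM; lra.
pose k := (n - j)%N.
have k0 : (0 < k)%N by rewrite subn_gt0.
have jk : (k < j)%N by rewrite /k; lia.
have jk0 : (0 < j - k)%N by rewrite subn_gt0.
have j0 : (0 < j)%N by apply: leq_trans jk.
have kE : k%:R = n%:R - j%:R :> R by rewrite natrB// ltnW.
have jkE : (j - k)%:R = 2 * j%:R - n%:R :> R by rewrite (natrB _ (ltnW jk)) kE; lra.
pose M := cursor_count F j n.
have HM : (j ^ j * r ^ k <= M * (k ^ k * (j - k) ^ (j - k)) * n.+1)%N.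
  apply: leq_trans (leq_mul (binomial_entropy (ltnW jk)) (leqnn (r ^ k)%N)) _.
  have := cursor_count_lower card_F (ltnW jn); rewrite -/k -/M => hM.
  rewrite [leqLHS](_ : _ = 'C(j, k) * r ^ k * (k ^ k * (j - k) ^ (j - k)) * j.+1)%N; last by ring.
  by rewrite leq_mul ?leq_mul// ltnS ltnW.
have M0 : (0 < M)%N := cursor_count_gt0 (ltnW jn) (ltnW nj).
have {}HM : j%:R * ln j%:R + k%:R * ln r%:R <=
    ln M%:R + (k%:R * ln k%:R + (j - k)%:R * ln (j - k)%:R) + ln n.+1%:R :> R.
  have p (m : nat) : (0 < m)%N -> m%:R \is @Num.pos R by rewrite posrE ltr0n.
  have px (m l : nat) : (0 < m)%N -> m%:R ^+ l \is @Num.pos R.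
    by move=> m0; rewrite posrE exprn_gt0// ltr0n.
  move: HM; rewrite -(@ler_nat R) !natrM !natrX => HM.
  rewrite -ler_ln ?rpredM ?px ?p// in HM; move: HM.
  rewrite !lnM ?rpredM ?px ?p// !lnXn ?ltr0n//.
  by rewrite -!(mulr_natl (ln _)).
have dv m : (0 < m)%N -> ln (m%:R / n%:R) = ln m%:R - ln n%:R :> R.
  by move=> m0; rewrite ln_div ?posrE ?ltr0n.
rewrite -/M; suff -> : n%:R * rate r (j%:R / n%:R) =
   j%:R * ln j%:R + k%:R * ln r%:R
    - (k%:R * ln k%:R + (j - k)%:R * ln (j - k)%:R) :> R by lra.
rewrite /rate; have -> : 1 - j%:R / n%:R = k%:R / n%:R :> R.
  by rewrite kE; field; rewrite gt_eqF.
have -> : 2 * (j%:R / n%:R) - 1 = (j - k)%:R / n%:R :> R.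
  by rewrite jkE; field; rewrite gt_eqF.
rewrite !dv//; set a := ln j%:R; set b := ln k%:R; set c := ln (j - k)%:R.
by rewrite jkE kE; field; rewrite gt_eqF.
Qed.

Lemma ln_cursor_count_upper (x : R) (j n : nat) : (0 < cursor_count F j n)%N ->
  1 / 2 < x -> x < 1 -> tilt r x ^+ 2 * (1 + r%:R * tilt r x) <= 1 ->
  ln (cursor_count F j n)%:R <= 2 * ln n.+1%:R + ln (1 + r%:R * tilt r x)
    + j%:R * ln (tilt r x + r%:R * tilt r x ^+ 2) - n%:R * ln (tilt r x) :> R.
Proof.
move=> M0 x1 x2 hz; have z0 := tilt_gt0 r_gt0 x1 x2.
have r0R : 0 < r%:R :> R by rewrite ltr0n.
have H := cursor_count_upper j n card_F z0 hz.
have w0 : 0 < 1 + r%:R * tilt r x by rewrite addr_gt0// mulr_gt0.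
have y0 : 0 < tilt r x + r%:R * tilt r x ^+ 2 by rewrite addr_gt0// mulr_gt0 ?exprn_gt0.
rewrite absz_nat -ler_ln ?posrE ?mulr_gt0 ?exprn_gt0 ?ltr0n// in H; move: H.
move: (tilt r x) z0 w0 y0 {hz} => z z0 w0 y0.
rewrite !lnM ?posrE ?mulr_gt0 ?exprn_gt0 ?ltr0n// !lnXn ?ltr0n//.
rewrite -!(mulr_natl (ln _)); lra.
Qed.

Lemma spectrum_rate (x : R) :
  1 / 2 < x -> x < 1 -> tilt r x ^+ 2 * (1 + r%:R * tilt r x) <= 1 ->
  spectrum F x = rate r x.
Proof.
move=> x1 x2 hz; apply: cvg_lim => //.
(* [v n] is the actual slope of the cursor: the lower bound is evaluated there, while the upper
   bound keeps the tilt of the limit slope [x]. *)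
pose v n : R := `|Num.floor (x * n%:R)|%N%:R / n%:R.
pose l n : R := ln n.+1%:R / n%:R.
have x0 : 0 <= x by lra.
have vx : v @ \oo --> x by exact: cvg_floor_div.
have l0 : l @ \oo --> 0 by exact: cvg_ln_div.
have lo : (fun n => rate r (v n) - l n) @ \oo --> rate r x.
  rewrite -[rate r x in X in _ --> X]subr0; apply: cvgB => //.
  apply: (cvg_comp _ _ vx); apply: differentiable_continuous.
  by apply/derivable1_diffP; have [] := is_derive_rate r x1 x2.
set y := tilt r x + r%:R * tilt r x ^+ 2.
have up : (fun n => 2 * l n + ln (1 + r%:R * tilt r x) / n%:R +
    v n * ln y - ln (tilt r x)) @ \oo --> rate r x.
  rewrite rate_tiltE// -/y.
  have -> : - ln (tilt r x) + x * ln y = 2 * 0 + 0 + x * ln y - ln (tilt r x) by ring.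
  apply: cvgB; last exact: cvg_cst.
  apply: cvgD; last by apply: cvgMl.
  apply: cvgD; last exact: cvg_cst_div.
  exact: cvgMr.
apply: (squeeze_cvgr _ lo up); near=> n.
have n0 : (0 < n)%N by near: n; exists 1%N.
have n0R : 0 < n%:R :> R by rewrite ltr0n.
have v1 : 1 / 2 < v n by near: n; exact: (cvgr_gt x).
have v2 : v n < 1 by near: n; exact: (cvgr_lt x).
have f0 : 0 <= Num.floor (x * n%:R) by rewrite floor_ge0 mulr_ge0.
have low := ln_cursor_count_lower v1 v2.
rewrite (gez0_abs f0) -/(v n) in low.
have M0 : (0 < cursor_count F (Num.floor (x * n%:R)) n)%N.
  rewrite -(gez0_abs f0); apply: cursor_count_gt0; rewrite -(ler_nat R) ?natrM.
    by move: v2; rewrite /v ltr_pdivrMr//; lra.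
  by move: v1; rewrite /v ltr_pdivlMr//; lra.
have upp := @ln_cursor_count_upper x `|Num.floor (x * n%:R)|%N n.
rewrite (gez0_abs f0) in upp; have {}upp := upp M0 x1 x2 hz.
have e1 : n%:R * l n = ln n.+1%:R by rewrite /l mulrC divfK// gt_eqF.
have e2 : n%:R * v n = `|Num.floor (x * n%:R)|%N%:R by rewrite /v mulrC divfK// gt_eqF.
apply/andP; split; first by rewrite ler_pdivlMl// mulrBr e1.
rewrite ler_pdivrMl//; apply: le_trans upp _; rewrite -/y -e1 -e2.
rewrite le_eqVlt; apply/orP; left; apply/eqP; field.
by rewrite gt_eqF.
Unshelve. all: by end_near. Qed.
End SpectrumValue.

(** Sweeping words with cursor from 0 to [n] suffice: their number satisfies the same recurrence as
    the powers of [omega]. *)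
Lemma card_ball_lower (R : realType) (F : finGroupType) (r n : nat) :
  (1 <= r)%N -> #|F| = r.+1 ->
  omega R r ^+ n <= omega R r * #|` fset_set (word_ball F n)|%:R.
Proof.
move=> r_gt0 cF; set w := omega R r.
have w1 : 1 < w := omega_gt1 R r_gt0.
pose a n := (\sum_(j < n.+1) 'C(j, n - j) * r ^ (n - j))%N.
(* The recurrence has order two, so two consecutive indices are carried along; the factor [w] covers
   the start, where [a 0 = a 1 = 1]. *)
have ha : w ^+ n <= w * (a n)%:R /\ w ^+ n.+1 <= w * (a n.+1)%:R.
  elim: n => [|n [IH1 IH2]].
    have -> : a 0%N = 1%N by rewrite /a big_ord_recl big_ord0.
    have -> : a 1%N = 1%N by rewrite /a !big_ord_recl big_ord0.
    by rewrite expr0 expr1; lra.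
  split=> //; rewrite /a binomial_sum_rec -/(a n.+1) -/(a n) natrD natrM.
  have -> : w ^+ n.+2 = w ^+ n.+1 + r%:R * w ^+ n.
    by rewrite -addn2 exprD [w ^+ 2]omega_sq -/w exprS; ring.
  rewrite mulrDr lerD// mulrCA ler_wpM2l//.
have [han _] := ha; apply: le_trans han _.
apply: ler_wpM2l; first by lra.
rewrite ler_nat.
apply: leq_trans (sum_cursor_count_le F n).
apply: leq_sum => j _; apply: cursor_count_lower => //.
by rewrite -ltnS.
Qed.

Lemma powR_three_halves (R : realType) (a : R) : 0 <= a ->
  a `^ (3 / 2) = Num.sqrt a ^+ 3.
Proof.
move=> a0; have -> : 3 / 2 = 2^-1 * 3%:R :> R by ring.
by rewrite powRrM powR12_sqrt// powR_mulrn// sqrtr_ge0.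
Qed.

(** * Derivatives of the growth defect, and the Chernoff bound *)

Section GrowthDefect.
Variables (R : realType) (F : finGroupType) (r : nat).
Hypotheses (r_gt0 : (1 <= r)%N) (card_F : #|F| = r.+1).

Let D : R := Num.sqrt (1 + 4 * r%:R) ^+ 3.

Lemma growth_defect_near :
  \forall x \near bar_beta R r, growth_defect F r x = ln (omega R r) - rate r x.
Proof.
near=> x; have [x1 x2 hz] : [/\ 1 / 2 < x, x < 1 &
  tilt r x ^+ 2 * (1 + r%:R * tilt r x) <= 1] by near: x; exact: tilt_near.
by rewrite /growth_defect (spectrum_rate r_gt0 card_F x1 x2 hz).
Unshelve. all: by end_near. Qed.

Lemma is_derive_growth_defect_near :
  \forall x \near bar_beta R r, is_derive (x : R) 1 (growth_defect F r) (- drate r x).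
Proof.
near=> x; have [x1 x2 _] : [/\ 1 / 2 < x, x < 1 &
  tilt r x ^+ 2 * (1 + r%:R * tilt r x) <= 1] by near: x; exact: tilt_near.
apply: (@near_eq_is_derive _ _ _ (cst (ln (omega R r)) - rate r)).
  (* A derivative at [x] requires the formula on a neighbourhood of [x], not only at [x];
     [near_join] provides it. *)
  have : \forall y \near x, growth_defect F r y = ln (omega R r) - rate r y.
    by near: x; exact: (near_join growth_defect_near).
  by apply: filterS => y ->.
have := is_deriveB (is_derive_cst (ln (omega R r)) x 1) (is_derive_rate r x1 x2).
by rewrite sub0r.
Unshelve. all: by end_near. Qed.

Lemma is_derive2_growth_defect :
  is_derive (bar_beta R r) 1 (derive1 (growth_defect F r)) (D / r%:R).
Proof.
apply: (@near_eq_is_derive _ _ _ (- drate r)).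
  near=> x; rewrite derive1E.
  have hx : is_derive (x : R) 1 (growth_defect F r) (- drate r x).
    by near: x; exact: is_derive_growth_defect_near.
  by rewrite derive_val.
have b1 := bar_beta_gt R r_gt0; have b2 := bar_beta_lt R r_gt0.
have := is_deriveN (is_derive_drate r b1 b2).
by rewrite ddrate_bar_beta// opprK.
Unshelve. all: by end_near. Qed.

Lemma rate_near_le (eps : R) : 0 < eps ->
  \forall x \near bar_beta R r,
    rate r x <= ln (omega R r) - (D / (2 * r%:R) - eps) * (x - bar_beta R r) ^+ 2.
Proof.
move=> eps0; have b1 := bar_beta_gt R r_gt0; have b2 := bar_beta_lt R r_gt0.
have h1 : \forall x \near bar_beta R r, is_derive (x : R) 1 (rate r) (drate r x).
  near=> x; have [x1 x2 _] : [/\ 1 / 2 < x, x < 1 &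
    tilt r x ^+ 2 * (1 + r%:R * tilt r x) <= 1] by near: x; exact: tilt_near.
  exact: is_derive_rate.
have := le_quadratic_near h1 (drate_bar_beta R r_gt0) (is_derive_drate r b1 b2) eps0.
apply: filterS => x; rewrite ddrate_bar_beta// rate_bar_beta//.
have -> : - (D / r%:R) / 2 + eps = - (D / (2 * r%:R) - eps).
  by field; rewrite pnatr_eq0 -lt0n.
by rewrite mulNr.
Unshelve. all: by end_near. Qed.

(** Each cursor in the tail is bounded with the tilt of the edge [b + s] or [b - s], so the
    quadratic bound on [rate] is used at distance exactly [s] from [b]. *)
Lemma card_deviation_le (eps : R) : 0 < eps -> exists2 delta : R, 0 < delta &
  forall (s : R) (n : nat), 0 < s -> s <= delta -> (1 <= n)%N ->
  #|` fset_set ([set x | s <= `| `|(cursor x)%:~R| / n%:R - bar_beta R r |]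
      `&` word_ball F n)|%:R
  <= 2 * n.+1%:R * (n.+1%:R ^+ 2 * (1 + r%:R) * (omega R r ^+ n *
       expR (- (n%:R * s ^+ 2 * (D / (2 * r%:R) - eps))))).
Proof.
move=> eps0; set b := bar_beta R r.
have [d /= d0 hd] : \forall x \near b, [/\ 1 / 2 < x, x < 1 &
     tilt r x ^+ 2 * (1 + r%:R * tilt r x) <= 1] /\
    rate r x <= ln (omega R r) - (D / (2 * r%:R) - eps) * (x - b) ^+ 2.
  near=> x; split; near: x; [exact: tilt_near | exact: rate_near_le].
have r0R : 0 < r%:R :> R by rewrite ltr0n.
have w1 := omega_gt1 R r_gt0.
(* The neighbourhood is an open ball of radius [d]; halving keeps both edges inside it. *)
exists (d / 2) => [|s n s0 sd n0]; first by rewrite divr_gt0.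
have n0R : 0 < n%:R :> R by rewrite ltr0n.
set E := _ * expR _.
have [hbs hE] : (forall x, `|x - b| = s ->
    [/\ 1 / 2 < x, x < 1 & tilt r x ^+ 2 * (1 + r%:R * tilt r x) <= 1]) /\
    (forall x, `|x - b| = s -> expR (n%:R * rate r x) <= E).
  have hball x : `|x - b| = s -> ball_ Num.norm b d x.
    by rewrite /= distrC => ->; lra.
  split=> x xs; have [hx1 hx2] := hd x (hball x xs); first exact: hx1.
  have {}xs : (x - b) ^+ 2 = s ^+ 2 by rewrite -xs real_normK// num_real.
  rewrite /E -[omega R r ^+ n]lnK ?posrE ?exprn_gt0//; last by lra.
  rewrite -expRD ler_expR lnXn//; last by lra.
  rewrite -(mulr_natl (ln _)).
  have -> : n%:R * ln (omega R r) + - (n%:R * s ^+ 2 * (D / (2 * r%:R) - eps)) =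
    n%:R * (ln (omega R r) - (D / (2 * r%:R) - eps) * s ^+ 2) by ring.
  by rewrite ler_wpM2l// -xs.
apply: card_ball_setI_le => [|j [x [/= xA xj]]].
  by rewrite !mulr_ge0 ?sqr_ge0 ?exprn_ge0 ?expR_ge0//; lra.
(* The edge [y] is the one on the side of [b] where [|j| / n] lies. *)
suff [y [ys hy]] : exists y, `|y - b| = s /\
    ((b <= y /\ y * n%:R <= `|j|%N%:R) \/ (y <= b /\ `|j|%N%:R <= y * n%:R)).
  have [y1 y2 hz] := hbs y ys.
  apply: le_trans (tilted_count r_gt0 card_F y1 y2 hz hy) _.
  apply: ler_wpM2l; last exact: hE.
  by rewrite mulr_ge0 ?sqr_ge0//; lra.
have jE : `|(cursor x)%:~R| = `|j|%N%:R :> R by rewrite xj natr_absz intr_norm.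
move: xA; rewrite jE ler_normr => /orP[h|h].
  exists (b + s); split; first by rewrite addrAC subrr add0r gtr0_norm.
  left; split; first by lra.
  by rewrite -ler_pdivlMr//; lra.
exists (b - s); split; first by rewrite addrAC subrr add0r normrN gtr0_norm.
right; split; first by lra.
by rewrite -ler_pdivrMr//; lra.
Unshelve. all: by end_near. Qed.

End GrowthDefect.

Theorem corollary1p5 (R : realType) (F : finGroupType) (r : nat)
    (r_gt0 : (1 <= r)%N) (card_F : #|F| = r.+1) :
  [/\ (\forall b \near bar_beta R r, derivable (growth_defect F r) b 1) /\
      is_derive (bar_beta R r) 1 (derive1 (growth_defect F r))
        ((1 + 4 * r%:R) `^ (3 / 2) / r%:R),
      forall eps : R, 0 < eps ->
        exists delta C : R, [/\ 0 < delta, 0 < C &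
          forall (s : R) (n : nat), 0 < s -> s <= delta -> (1 <= n)%N ->
          forall (d : measure_display) (T : measurableType d)
                 (P : probability T R) (Z : {RV P >-> lamplighter F}),
            uniform_on (word_ball F n) Z ->
            (P [set w | (s <= `| `|(cursor (Z w))%:~R| / n%:R - bar_beta R r |)%R]
             <= (C * n%:R ^+ 3 *
                 expR (- (n%:R * s ^+ 2 *
                   ((1 + 4 * r%:R) `^ (3 / 2) / (2 * r%:R) - eps))))%R%:E)%E]
    & r = 1%N ->
      (1 + 4 * r%:R) `^ (3 / 2) / (2 * r%:R) = 5 * Num.sqrt 5 / 2 :> R].
Proof.
have a0 : 0 <= 1 + 4 * r%:R :> R by rewrite addr_ge0// mulr_ge0.
rewrite !powR_three_halves//.
split.
- split; last exact: is_derive2_growth_defect.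
  apply: filterS (is_derive_growth_defect_near R r_gt0 card_F) => x [] //.
- move=> eps eps0; have [delta delta0 hdelta] := card_deviation_le r_gt0 card_F eps0.
  have w1 := omega_gt1 R r_gt0.
  have r0R : 0 < r%:R :> R by rewrite ltr0n.
  (* Here [16 = 2 * 2 ^ 3]: the 2 counts the signs of the cursor and the cube comes from
     [n + 1 <= 2 * n]. The factor [omega] is the loss in the lower bound for the ball. *)
  exists delta, (16 * (1 + r%:R) * omega R r); split => //.
    by rewrite !mulr_gt0//; lra.
  move=> s n s0 sd n1 d T P Z unifZ.
  pose A := [set x : lamplighter F |
    s <= `| `|(cursor x)%:~R| / n%:R - bar_beta R r |].
  have := unifZ A; rewrite /distribution /pushforward => ->; rewrite lee_fin.
  have := hdelta s n s0 sd n1; rewrite -/A.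
  set E := expR _; set B := #|` fset_set (word_ball F n)| => hA.
  have hB : omega R r ^+ n <= omega R r * B%:R := card_ball_lower R n r_gt0 card_F.
  have wn0 : 0 < omega R r ^+ n by rewrite exprn_gt0//; lra.
  (* The lower bound also makes the cardinality of the ball positive, so the denominator can be
     cleared. *)
  have B0 : 0 < B%:R :> R.
    by have := lt_le_trans wn0 hB; rewrite pmulr_rgt0//; lra.
  rewrite ler_pdivrMr//; apply: le_trans hA _.
  have E0 : 0 <= E := expR_ge0 _.
  have nn : n.+1%:R <= 2 * n%:R :> R.
    by move: n1; rewrite -natr1 -(ler1n R); lra.
  have n3 : n.+1%:R ^+ 3 <= (2 * n%:R) ^+ 3 :> R by rewrite lerXn2r ?nnegrE ?mulr_ge0.
  have -> : 2 * n.+1%:R * (n.+1%:R ^+ 2 * (1 + r%:R) * (omega R r ^+ n * E)) =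
    (2 * (1 + r%:R) * E) * (n.+1%:R ^+ 3 * omega R r ^+ n) :> R by ring.
  have -> : 16 * (1 + r%:R) * omega R r * n%:R ^+ 3 * E * B%:R =
    (2 * (1 + r%:R) * E) * ((2 * n%:R) ^+ 3 * (omega R r * B%:R)) :> R by ring.
  apply: ler_wpM2l; first by rewrite !mulr_ge0//; lra.
  by apply: ler_pM => //; exact: ltW.
- move=> ->; have -> : 1 + 4 * 1%:R = 5 :> R by lra.
  by rewrite exprS sqr_sqrtr// mulr1 [_ * 5]mulrC.
Qed.
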